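(* For every integer $h\ge0$ and every real $r>0$, $$P_h(X,r)=\det\bigl(I-\sqrt X\,A_h(r)\bigr),$$ where $I$ is the identity matrix of the appropriate size, the determinant of a $0\times0$ matrix is one, and the right-hand side is understood as the resulting polynomial in $X$ (independent of the choice of square-root branch). For $h\ge2$, the zeros of $P_h(X,r)$ in $X$ are positive real numbers, and the smallest positive zero is $\Lambda_h(r)^{-1}$.
   Context: For $h\ge0$, $P_h(X,Q)=\sum_{m=0}^{\lfloor h/2\rfloor}(-X)^mQ^{m(m-1)}\begin{bmatrix} h-m \\ m \end{bmatrix}_Q$, where $\begin{bmatrix} N \\ m \end{bmatrix}_Q$ is the Gaussian binomial polynomial in $Q$ (so $P_0=P_1=1$). For $r>0$, $A_0(r)$ is the empty matrix, $A_1(r)$ is the $1\times1$ zero matrix, and for $h\ge2$, $A_h(r)$ is the $h\times h$ real symmetric tridiagonal matrix with zero diagonal and $(A_h(r))_{i,i+1}=(A_h(r))_{i+1,i}=r^{(i-1)/2}$ for $1\le i\le h-1$. For $h\ge1$, $\lambda_h(r)$ is the spectral radius of $A_h(r)$ and $\Lambda_h(r)=\lambda_h(r)^2$. *)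

(* Defs.v *)
From mathcomp Require Import all_boot all_order all_algebra.
From mathcomp Require Import boolp classical_sets reals exp.
From mathcomp Require Import complex.

Set Implicit Arguments.
Unset Strict Implicit.
Unset Printing Implicit Defensive.

Import Order.TTheory GRing.Theory Num.Theory.
Local Open Scope classical_set_scope.
Local Open Scope ring_scope.
Local Open Scope complex_scope.

(* The Gaussian binomial [N, m]_Q as a polynomial in Q (here 'X). The divisor
   is monic and the division is exact; for m > N the numerator contains the
   factor 'X^0 - 1 = 0. *)
Definition gauss_binom (F : fieldType) (N m : nat) : {poly F} :=
  (\prod_(i < m) ('X^(N - i) - 1)) %/ (\prod_(i < m) ('X^(i.+1) - 1)).

(* P_h(X, Q) as a polynomial in X (outer variable) whose coefficients are
   polynomials in Q (inner variable). *)
Definition P (F : fieldType) (h : nat) : {poly {poly F}} :=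
  \sum_(m < (h./2).+1)
    (- 'X) ^+ m * ('X^(m * (m - 1)) * gauss_binom F (h - m) m)%:P.

(* P_h(X, r), a polynomial in X. *)
Definition Pat (F : fieldType) (h : nat) (r : F) : {poly F} :=
  map_poly (horner_eval r) (P F h).

(* Indices are 0-based: the (i, i+1) entry is r^(i/2). *)
Definition A (R : realType) (h : nat) (r : R) : 'M[R]_h :=
  \matrix_(i < h, j < h)
    if (j : nat) == i.+1 then r `^ (i%:R / 2)
    else if (i : nat) == j.+1 then r `^ (j%:R / 2)
    else 0.

Definition spectral_radius (R : realType) (n : nat) (M : 'M[R[i]]_n) : R :=
  sup [set Normc.normc z | z in [set z : R[i] | eigenvalue M z]].

Definition lambda (R : realType) (h : nat) (r : R) : R :=
  spectral_radius (map_mx (real_complex R) (A h r)).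

Definition Lambda (R : realType) (h : nat) (r : R) : R := lambda h r ^+ 2.

(* Main.v *)
(* Pascal's rule for Gaussian binomials gives
     P_{h+2}(X) = P_{h+1}(X) - X r^h P_h(X),
   which after X := X^2 is also the recurrence obtained by expanding the
   tridiagonal determinant det(I - X A_h) along its last row. Hence, for
   w <> 0, w^2 is a zero of P_h exactly when 1/w is an eigenvalue of A_h. These
   are real because A_h is symmetric, so the zeros are the numbers 1/y^2 for y
   a nonzero eigenvalue, and the smallest comes from the largest |y|. For
   h >= 2 there is at least one zero: the coefficient of X is negative. *)
Require Import Defs.
From mathcomp Require Import all_boot all_order all_algebra.
From mathcomp Require Import boolp classical_sets reals exp.
From mathcomp Require Import complex ring zify.

Import Order.TTheory GRing.Theory Num.Theory.
Local Open Scope ring_scope.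
Local Open Scope complex_scope.

Set Implicit Arguments.
Unset Strict Implicit.

(** * Gaussian binomials and the recurrence for [P] *)

Section Gauss.
Variable F : fieldType.

Let num N m : {poly F} := \prod_(i < m) ('X^(N - i) - 1).
Let den m : {poly F} := \prod_(i < m) ('X^(i.+1) - 1).

Lemma gauss_num_eq0 N m : (N < m)%N -> num N m = 0.
Proof.
by move=> Nm; rewrite /num (bigD1 (Ordinal Nm)) //= subnn subrr mul0r.
Qed.

Lemma gauss_denS m : den m.+1 = den m * ('X^(m.+1) - 1).
Proof. by rewrite /den big_ord_recr. Qed.

Lemma gauss_den_neq0 m : den m != 0.
Proof.
apply/prodf_neq0 => i _; apply: monic_neq0.
by rewrite -polyC1 monicXnsubC.
Qed.

(** Both numerators of length [m.+1] contain the factor [num N m]; the rest is ['X^(N.+1) - 1 =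
    ('X^(N - m) - 1) + 'X^(N - m) * ('X^(m.+1) - 1)]. *)
Lemma gauss_num_pascal N m :
  num N.+1 m.+1 = num N m.+1 + 'X^(N - m) * num N m * ('X^(m.+1) - 1).
Proof.
rewrite {1}/num big_ord_recl subn0 /=.
rewrite (eq_bigr (fun i : 'I_m => 'X^(N - i) - 1)); last first.
  by move=> i _; rewrite subSS.
rewrite -/(num N m) {2}/num big_ord_recr /= -/(num N m).
case: (leqP m N) => [mN|Nm]; last by rewrite gauss_num_eq0 // !(mulr0, mul0r) addr0.
have -> : N.+1 = (N - m + m.+1)%N by rewrite addnS subnK.
by rewrite exprD; ring.
Qed.

(** Makes the Euclidean quotient in [gauss_binom] exact, so that Pascal's rule for numerators
    descends to the quotients. *)
Lemma gauss_den_dvd N m : den m %| num N m.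
Proof.
elim: N m => [|N IH] [|m].
- by rewrite /den big_ord0 dvd1p.
- by rewrite gauss_num_eq0 // dvdp0.
- by rewrite /den big_ord0 dvd1p.
rewrite gauss_num_pascal dvdp_add // gauss_denS dvdp_mul //.
exact: dvdp_mull.
Qed.

Lemma gauss_binom_small N m : (N < m)%N -> gauss_binom F N m = 0.
Proof. by move=> Nm; rewrite /gauss_binom -/(num N m) gauss_num_eq0 // div0p. Qed.

Lemma gauss_binom0 N : gauss_binom F N 0 = 1.
Proof. by rewrite /gauss_binom !big_ord0 divp1. Qed.

Lemma gauss_binomS N m : gauss_binom F N.+1 m.+1 =
  gauss_binom F N m.+1 + 'X^(N - m) * gauss_binom F N m.
Proof.
apply: (mulIf (gauss_den_neq0 m.+1)); rewrite mulrDl.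
rewrite [LHS]divpK ?gauss_den_dvd // [X in _ = X + _]divpK ?gauss_den_dvd //.
rewrite -/(num N.+1 m.+1) gauss_num_pascal gauss_denS -/(num N m.+1).
by rewrite -[in LHS](divpK (gauss_den_dvd N m)) !mulrA.
Qed.

(** The formula extends past the summation bound because the binomial vanishes once [h - m < m]. *)
Lemma coef_P h m :
  (P F h)`_m = (-1) ^+ m * ('X^(m * (m - 1)) * gauss_binom F (h - m) m).
Proof.
have -> : P F h = \poly_(m < h./2.+1)
    ((-1) ^+ m * ('X^(m * (m - 1)) * gauss_binom F (h - m) m)).
  rewrite poly_def; apply: eq_bigr => i _.
  rewrite -mul_polyC [in RHS]polyCM polyC_exp polyCN exprNn.
  by rewrite -!mulrA; congr (_ * _); rewrite mulrC.
rewrite coef_poly; case: ltnP => // hm.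
by rewrite gauss_binom_small ?mulr0 //; lia.
Qed.

(** Pascal's rule splits each coefficient of positive degree into one coefficient of [P F h.+1] and
    a shifted one of [P F h]. *)
Lemma P_rec h : P F h.+2 = P F h.+1 - ('X^h)%:P * 'X * P F h.
Proof.
apply/polyP => -[|m]; rewrite coefB -mulrA coefCM coefXM !coef_P /=.
  by rewrite !gauss_binom0 mulr0 subr0.
case: (leqP m h) => [mh|hm]; last first.
  by rewrite !gauss_binom_small ?(mulr0, subr0) //; lia.
rewrite !subSS !subSn // gauss_binomS.
case: (leqP m (h - m)) => hm; last first.
  by rewrite !gauss_binom_small ?(mulr0, addr0, subr0) //; lia.
rewrite subn0.
(* Here [m <= h - m], so [h - m - m] is a true difference; at [m = 0] the truncated [m - 1] is
   multiplied by 0. *)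
have E : (m.+1 * m + (h - m - m) = h + m * (m - 1))%N by nia.
have {}E : 'X^(m.+1 * m) * 'X^(h - m - m) = 'X^h * 'X^(m * (m - 1)) :> {poly F}.
  by rewrite -!exprD E.
move: E; rewrite exprS.
(* The powers become atoms for [ring], linked only by [a * b = c * d]. *)
move: 'X^(m.+1 * m) 'X^(h - m - m) 'X^h 'X^(m * (m - 1)) => a b c d E.
by ring: E.
Qed.

Lemma P0 : P F 0 = 1.
Proof.
apply/polyP => -[|m]; rewrite coef_P coef1 /=.
  by rewrite gauss_binom0 !expr0 !mul1r.
by rewrite gauss_binom_small ?mulr0.
Qed.

Lemma P1 : P F 1 = 1.
Proof.
apply/polyP => -[|m]; rewrite coef_P coef1 /=.
  by rewrite gauss_binom0 !expr0 !mul1r.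
by rewrite gauss_binom_small ?mulr0 //; lia.
Qed.

Lemma Pat0 r : Pat 0 r = 1 :> {poly F}.
Proof. by rewrite /Pat P0 rmorph1. Qed.

Lemma Pat1 r : Pat 1 r = 1 :> {poly F}.
Proof. by rewrite /Pat P1 rmorph1. Qed.

Lemma Pat_rec h (r : F) :
  Pat h.+2 r = Pat h.+1 r - (r ^+ h)%:P * 'X * Pat h r.
Proof.
by rewrite /Pat P_rec rmorphB !rmorphM /= map_polyC map_polyX /= horner_evalE hornerXn.
Qed.

End Gauss.

(** * Tridiagonal determinants and the determinant formula *)

Section Tridiagonal.
Variables (K : comPzRingType) (f : nat -> nat -> K).
Hypothesis f_tridiag : forall i j, (i.+1 < j)%N || (j.+1 < i)%N -> f i j = 0.

(** Indexing the entries by [nat] makes all the matrices leading blocks of one array, so minors of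
    the large one are again values of [D]. *)
Lemma det_tridiag n :
  let D n := \det (\matrix_(i < n, j < n) f i j) in
  D n.+2 = f n.+1 n.+1 * D n.+1 - f n n.+1 * f n.+1 n * D n.
Proof.
move=> D; rewrite {1}/D (expand_det_row _ ord_max) 2!big_ord_recr /=.
rewrite big1 => [|i _]; last first.
  by rewrite mxE f_tridiag ?mul0r //=; have := ltn_ord i; lia.
rewrite add0r addrC !mxE /=; congr (_ + _).
  rewrite /cofactor /= -signr_odd addnn odd_double expr0 mul1r; congr (_ * \det _).
  apply/matrixP => i j; rewrite !mxE /= /bump.
  by rewrite (ltn_geF (ltn_ord i)) (ltn_geF (ltn_ord j)).
rewrite /cofactor /= -signr_odd addSn addnn /= odd_double expr1.
(* Without the last row and column [n], the last column has entries [f i n.+1]; only [f n n.+1] can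
   be nonzero. *)
rewrite (expand_det_col _ ord_max) big_ord_recr /= big1 => [|i _]; last first.
  rewrite !mxE f_tridiag ?mul0r //= /bump /= leqnn.
  by have := ltn_ord i; lia.
rewrite add0r !mxE /= /bump !leqnn ltnn /= add0n add1n.
rewrite /cofactor -signr_odd addnn odd_double expr0 mul1r.
set M := \det _; have -> : M = D n.
  congr (\det _); apply/matrixP => i j; rewrite !mxE /= /bump /=.
  have i_n1 : (n < i)%N = false by rewrite ltn_geF // ltnS ltnW.
  by rewrite (ltn_geF (ltn_ord i)) (ltn_geF (ltn_ord j)) !add0n i_n1 (ltn_geF (ltn_ord j)).
by ring.
Qed.

End Tridiagonal.

Lemma Pat_det (R : realType) (h : nat) (r : R) : 0 < r ->
  (Pat h r) \Po 'X^2 = \det (1%:M - 'X *: map_mx polyC (A h r)).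
Proof.
move=> r0.
pose a i j : R := if j == i.+1 then r `^ (i%:R / 2)
  else if i == j.+1 then r `^ (j%:R / 2) else 0.
pose f i j : {poly R} := (i == j)%:R - 'X * (a i j)%:P.
have fE n : 1%:M - 'X *: map_mx polyC (A n r) = \matrix_(i < n, j < n) f i j.
  by apply/matrixP => i j; rewrite !mxE.
have f0 i j : (i.+1 < j)%N || (j.+1 < i)%N -> f i j = 0.
  move=> ij; rewrite /f /a.
  have [-> -> ->] : [/\ (i == j) = false, (j == i.+1) = false & (i == j.+1) = false].
    by split; lia.
  by rewrite mulr0 subr0.
rewrite fE.
(* The recurrence has order two, so the induction carries two consecutive cases. *)
suff: Pat h r \Po 'X^2 = \det (\matrix_(i < h, j < h) f i j) /\
  Pat h.+1 r \Po 'X^2 = \det (\matrix_(i < h.+1, j < h.+1) f i j) by case.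
elim: h => [|h [IH0 IH1]].
  rewrite Pat0 Pat1 det_mx00 det_mx11 mxE /f /a /= mulr0 subr0.
  by rewrite -polyC1 comp_polyC.
split=> //; rewrite det_tridiag // -IH0 -IH1 Pat_rec.
rewrite linearB /= !comp_polyM comp_polyC comp_polyX.
have -> : f h.+1 h.+1 = 1 by rewrite /f /a eqxx ltn_eqF // mulr0 subr0.
(* The two equal off-diagonal entries multiply to the coefficient [r ^+ h] of [Pat_rec]. *)
have rh : r `^ (h%:R / 2) * r `^ (h%:R / 2) = r ^+ h.
  by rewrite -powRD ?(gt_eqF r0) ?implybT // -splitr powR_mulrn // ltW.
have -> : f h h.+1 = - ('X * (r `^ (h%:R / 2))%:P).
  by rewrite /f /a eqxx ltn_eqF // sub0r.
have -> : f h.+1 h = - ('X * (r `^ (h%:R / 2))%:P).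
  by rewrite /f /a eqxx gtn_eqF // ltn_eqF // sub0r.
by rewrite mul1r -rh polyCM; ring.
Qed.

(** * Zeros of [Pat] and eigenvalues of [A] *)

Lemma coef0_Pat (F : fieldType) (h : nat) (r : F) : (Pat h r)`_0 = 1.
Proof.
by rewrite /Pat coef_map coef_P gauss_binom0 !expr0 !mul1r /= horner_evalE hornerC.
Qed.

Lemma coef1_Pat_lt0 (R : realFieldType) (h : nat) (r : R) :
  0 < r -> (1 < h)%N -> (Pat h r)`_1 < 0.
Proof.
move=> r0; case: h => [|[|h]] // _.
have coef1_rec k : (Pat k.+2 r)`_1 = (Pat k.+1 r)`_1 - r ^+ k.
  by rewrite Pat_rec coefB -mulrA coefCM coefXM /= coef0_Pat mulr1.
elim: h => [|h IH]; rewrite coef1_rec.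
  by rewrite Pat1 coef1 expr0 sub0r ltrN10.
by rewrite ltrBlDr add0r (lt_trans IH) ?exprn_gt0.
Qed.

(* For v M = a v and w the conjugate of v, the symmetry of M turns v M w^T into
   both a (v w^T) and conj(a) (v w^T), and v w^T > 0. *)
Lemma real_symmetric_eigenvalue (R : rcfType) (n : nat) (M : 'M[R]_n) (a : R[i]) :
  M^T = M -> eigenvalue (map_mx (real_complex R) M) a -> exists x : R, a = x%:C.
Proof.
move=> Msym /eigenvalueP[v vM v0].
set MC := map_mx _ M in vM.
pose w := map_mx conjc v.
have wM : w *m MC = conjc a *: w.
  have <- : map_mx conjc MC = MC.
    by apply/matrixP => i j; rewrite !mxE conjc_real.
  by rewrite -map_mxM vM map_mxZ.
have MCsym : MC^T = MC by rewrite /MC map_trmx Msym.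
have av : a *: (v *m w^T) = conjc a *: (v *m w^T).
  by rewrite scalemxAl -vM -mulmxA -{1}MCsym -trmx_mul wM linearZ /= -scalemxAr.
have vw0 : (v *m w^T) 0 0 != 0.
  have -> : (v *m w^T) 0 0 = \sum_j `|v 0 j| ^+ 2.
    by rewrite mxE; apply: eq_bigr => j _; rewrite !mxE sqr_normc.
  rewrite psumr_eq0 => [|j _]; last by rewrite exprn_ge0.
  apply: contra v0 => /allP v0; apply/eqP/rowP => j; rewrite mxE.
  by have := v0 j (mem_index_enum _); rewrite sqrf_eq0 normr_eq0 => /eqP.
have {av} : a = conjc a.
  by move/matrixP: av => /(_ 0 0); rewrite mxE [RHS]mxE => /(mulIf vw0).
case: a vM wM => x y _ _ [/eqP]; rewrite -addr_eq0 -mulr2n mulrn_eq0 /= => /eqP ->.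
by exists x.
Qed.

Lemma A_sym (R : realType) h (r : R) : (A h r)^T = A h r.
Proof.
apply/matrixP => i j; rewrite !mxE.
case: (eqVneq (i : nat) j.+1) => // ij.
by rewrite ltn_eqF // ij.
Qed.

(** The characteristic polynomial at [w^-1] is [w^-1 ^+ h] times the determinant of
    [1%:M - w *: MC], whose vanishing is governed by [Pat_det] evaluated at [w]. *)
Lemma eigenvalue_A (R : realType) h (r : R) (w : R[i]) : 0 < r -> w != 0 ->
  eigenvalue (map_mx (real_complex R) (A h r)) w^-1 =
  root (map_poly (real_complex R) (Pat h r)) (w ^+ 2).
Proof.
move=> r0 w0; set MC := map_mx _ _.
have -> : root (map_poly (real_complex R) (Pat h r)) (w ^+ 2) =
    (\det (1%:M - w *: MC) == 0).
  have -> : w ^+ 2 = ('X^2).[w] by rewrite hornerXn.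
  rewrite /root -horner_comp -(map_polyXn (real_complex R)) -map_comp_poly Pat_det //.
  rewrite -det_map_mx -[_.[w]]/(horner_eval w _) -det_map_mx.
  congr (\det _ == 0); apply/matrixP => i j.
  by rewrite !mxE !rmorphB !rmorphM !rmorph_nat /= !map_polyC map_polyX /= !horner_evalE
    hornerX hornerC /=.
rewrite eigenvalue_root_char /root /char_poly -[_.[_]]/(horner_eval _ _) -det_map_mx.
have -> : map_mx (horner_eval w^-1) (char_poly_mx MC) = w^-1 *: (1%:M - w *: MC).
  rewrite scalerBr scalerA mulVf // scale1r scalemx1 /char_poly_mx.
  apply/matrixP => i j.
  by rewrite !mxE horner_evalE hornerD hornerN hornerC hornerMn hornerX.
by rewrite detZ mulf_eq0 expf_eq0 invr_eq0 (negbTE w0) andbF.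
Qed.

(** * The spectral radius as an attained maximum *)

Lemma seq_argmax (T : eqType) (R : realDomainType) (f : T -> R) (s : seq T) (x : T) :
  x \in s -> exists2 a, a \in s & forall b, b \in s -> f b <= f a.
Proof.
elim: s x => // y s IH x _.
case: s IH => [_|z s IH].
  by exists y; rewrite ?inE // => b; rewrite inE => /eqP ->.
have [a a_s a_max] := IH z (mem_head _ _).
have [fya|fay] := leP (f y) (f a).
  exists a; first by rewrite inE a_s orbT.
  by move=> b; rewrite inE => /predU1P[->|/a_max].
exists y; first by rewrite mem_head.
by move=> b; rewrite inE => /predU1P[->//|/a_max fb]; rewrite (le_trans fb) ?ltW.
Qed.

(** The characteristic polynomial splits over [R[i]], so the eigenvalues form a finite list. The
    eigenvalue [a] rules out the empty set, where [sup] is a default value. *)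
Lemma spectral_radius_max (R : realType) n (M : 'M[R[i]]_n) (a : R[i]) :
  eigenvalue M a -> exists b, [/\ eigenvalue M b,
    spectral_radius M = Normc.normc b
    & forall c, eigenvalue M c -> Normc.normc c <= Normc.normc b].
Proof.
move=> a_ev.
have [rs rsE] := closed_field_poly_normal (char_poly M).
have evE z : eigenvalue M z = (z \in rs).
  rewrite eigenvalue_root_char rsE (monicP (char_poly_monic M)) scale1r.
  by rewrite root_prod_XsubC.
have a_rs : a \in rs by rewrite -evE.
have [b b_rs b_max] := seq_argmax (@Normc.normc R) a_rs.
have b_ev : eigenvalue M b by rewrite evE.
exists b; split=> //.
- rewrite /spectral_radius; set S := (X in sup X).
  have S_ub : ubound S (Normc.normc b).
    by move=> _ [z z_ev <-]; apply: b_max; rewrite -evE.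
  have S_b : S (Normc.normc b) by exact: (ex_intro2 _ _ b b_ev erefl).
  have S_bounded : has_ubound S by exists (Normc.normc b).
  apply/le_anti; rewrite (ub_le_sup S_bounded S_b) andbT.
  by apply: ge_sup S_ub; exists (Normc.normc b).
- by move=> c; rewrite evE => /b_max.
Qed.

Lemma normc_real (R : rcfType) (x : R) : Normc.normc x%:C = `|x|.
Proof. by rewrite /Normc.normc /= expr0n addr0 sqrtr_sqr. Qed.

(** The constant coefficient 1 excludes [z = 0]; then the inverse of [sqrtC z] is an eigenvalue,
    hence real, and [z] is its inverse square. *)
Lemma Pat_root_real (R : realType) h (r : R) (z : R[i]) : 0 < r ->
  root (map_poly (real_complex R) (Pat h r)) z -> exists2 x : R, 0 < x & z = x%:C.
Proof.
move=> r0 z_root.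
have z0 : z != 0.
  apply: contraTneq z_root => ->.
  by rewrite /root horner_coef0 coef_map coef0_Pat fmorph_eq0 oner_eq0.
have w0 : sqrtC z != 0 by rewrite sqrtC_eq0.
rewrite -(sqrtCK z) -eigenvalue_A // in z_root.
have [x xE] := real_symmetric_eigenvalue (A_sym h r) z_root.
have zE : z = (x^-1 ^+ 2)%:C.
  by rewrite rmorphXn fmorphV /= -xE invrK sqrtCK.
exists (x^-1 ^+ 2) => //.
rewrite lt_neqAle sqr_ge0 andbT eq_sym.
by apply: contra z0 => /eqP x0; rewrite zE x0.
Qed.

(* The indeterminate 'X of the first identity stands for the square root of X:
   it is an identity in R[sqrt X], with X = (sqrt X)^2. *)
Theorem proposition7p1 (R : realType) (h : nat) (r : R) (r_gt0 : 0 < r) :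
  (Pat h r) \Po 'X^2 = \det (1%:M - 'X *: map_mx polyC (A h r))
  /\ ((2 <= h)%N ->
      (forall z : R[i], root (map_poly (real_complex R) (Pat h r)) z ->
         exists2 x : R, 0 < x & z = x%:C)
      /\ [/\ 0 < (Lambda h r)^-1,
             root (Pat h r) (Lambda h r)^-1
           & forall x : R, 0 < x -> root (Pat h r) x ->
               (Lambda h r)^-1 <= x]).
Proof.
split; first exact: Pat_det.
move=> h_ge2; split; first by move=> z; exact: Pat_root_real.
have eigen_sqrt x : 0 < x -> root (Pat h r) x ->
    eigenvalue (map_mx (real_complex R) (A h r)) (Num.sqrt x)^-1%:C.
  move=> x0 x_root; rewrite fmorphV eigenvalue_A //; last first.
    by rewrite fmorph_eq0 gt_eqF ?sqrtr_gt0.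
  by rewrite -rmorphXn sqr_sqrtr ?fmorph_root // ltW.
(* A nonconstant polynomial has a complex zero, which [Pat_root_real] makes real and positive. *)
have [x0 x0_gt0 x0_root] : exists2 x : R, 0 < x & root (Pat h r) x.
  have /closed_rootP[z z_root] : size (map_poly (real_complex R) (Pat h r)) != 1.
    rewrite size_map_poly; apply: contraTneq (coef1_Pat_lt0 r_gt0 h_ge2) => s1.
    by rewrite nth_default ?ltxx // s1.
  have [x x_gt0 zx] := Pat_root_real r_gt0 z_root.
  by exists x => //; rewrite zx fmorph_root in z_root.
have [b [b_ev lambdaE b_max]] := spectral_radius_max (eigen_sqrt _ x0_gt0 x0_root).
have [y yE] := real_symmetric_eigenvalue (A_sym h r) b_ev.
have y_max x : 0 < x -> root (Pat h r) x -> (Num.sqrt x)^-1 <= `|y|.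
  move=> x_gt0 /(eigen_sqrt _ x_gt0)/b_max; rewrite yE !normc_real.
  by rewrite ger0_norm // invr_ge0 sqrtr_ge0.
(* The zero [x0] forces a nonzero eigenvalue, so [(Lambda h r)^-1] is a genuine inverse. *)
have y0 : 0 < `|y|.
  by apply: lt_le_trans (y_max _ x0_gt0 x0_root); rewrite invr_gt0 sqrtr_gt0.
have -> : Lambda h r = `|y| ^+ 2 by rewrite /Lambda /lambda lambdaE yE normc_real.
split; first by rewrite invr_gt0 exprn_gt0.
(* Over [R[i]] the candidate zero is the square of [(y%:C)^-1], so [eigenvalue_A] applies. *)
- rewrite real_normK ?num_real // -(fmorph_root (real_complex R)).
  rewrite [X in root _ X](_ : _ = (y%:C)^-1 ^+ 2); last first.
    by rewrite fmorphV rmorphXn /= exprVn.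
  have yV_neq0 : (y%:C)^-1 != 0 by rewrite invr_eq0 fmorph_eq0 -normr_gt0.
  by rewrite -(eigenvalue_A h r_gt0 yV_neq0) invrK -yE.
- move=> x x_gt0 x_root.
  (* Inverting turns the claim into the square of the bound [y_max]. *)
  rewrite -[x]invrK lef_pV2 ?posrE ?invr_gt0 ?exprn_gt0 //.
  have -> : x^-1 = (Num.sqrt x)^-1 ^+ 2 by rewrite exprVn sqr_sqrtr // ltW.
  rewrite lerXn2r ?nnegrE ?invr_ge0 ?sqrtr_ge0 //.
  exact: y_max.
Qed.
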